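(* Let $q$ be an indeterminate, $[n]=1+q+\dots+q^{n-1}$, $[n]!=[1]\cdots[n]$, and let $e_n(q)\in\mathbb{Q}(q)$ ($n\ge1$) be the coefficients of the power product expansion $\sum_{n\ge0}\frac{x^n}{[n]!}=\prod_{n\ge1}(1+e_n(q)x^n)$. Let $u_n(q)=\prod_{j=1}^n\gcd([j],[n])$, where $\gcd$ denotes the monic greatest common divisor of polynomials, and set $r_n(q)=u_n(q)e_n(q)$. Then for every $n>1$, $(-1)^n r_n(q)$ is a polynomial in $q$ with integer coefficients and with leading coefficient $1$.
   Context: A power product expansion of a formal power series $f(x)=\sum_{n\ge0}a_nx^n$ with $a_0=1$ is the unique representation $f(x)=\prod_{n\ge1}(1+g_nx^n)$ (here over the field $\mathbb{Q}(q)$). *)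

(* Defs.v *)
From mathcomp Require Import all_boot all_order all_algebra.

Set Implicit Arguments.
Unset Strict Implicit.
Unset Printing Implicit Defensive.

Import GRing.Theory.
Local Open Scope ring_scope.

Definition pprod (K : fieldType) (g : nat -> K) (N : nat) : {poly K} :=
  \prod_(1 <= k < N.+1) (1 + g k *: 'X^k).

(* A formal power series over K is represented by its coefficient sequence
   [nat -> K].  The infinite product converges coefficientwise: the m-th
   coefficient of the finite products is eventually constant, with value a_m.
   The value [g 0] plays no role. *)
Definition power_product_expansion (K : fieldType) (a g : nat -> K) : Prop :=
  forall m : nat, exists N0 : nat, forall N : nat, (N0 <= N)%N ->
    (pprod g N)`_m = a m.

Section ExistenceUniqueness.

Variable K : fieldType.
Implicit Types a g : nat -> K.

Lemma pprodS g N : pprod g N.+1 = pprod g N * (1 + g N.+1 *: 'X^(N.+1)).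
Proof. by rewrite /pprod big_nat_recr. Qed.

Lemma coef_pprodS g N m : (pprod g N.+1)`_m =
  (pprod g N)`_m + g N.+1 * (if (m < N.+1)%N then 0 else (pprod g N)`_(m - N.+1)).
Proof. by rewrite pprodS mulrDr mulr1 coefD -scalerAr coefZ coefMXn. Qed.

Lemma coef_pprod_stable g m N : (m <= N)%N -> (pprod g N)`_m = (pprod g m)`_m.
Proof.
elim: N => [|N IH]; first by rewrite leqn0 => /eqP->.
rewrite leq_eqVlt => /predU1P[-> //|lt_mN].
by rewrite coef_pprodS lt_mN mulr0 addr0 IH.
Qed.

Lemma coef_pprod0 g N : (pprod g N)`_0 = 1.
Proof. by rewrite coef_pprod_stable // /pprod big_nil coef1. Qed.

Lemma coef_pprod_diag g N : (pprod g N.+1)`_N.+1 = (pprod g N)`_N.+1 + g N.+1.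
Proof. by rewrite coef_pprodS ltnn subnn coef_pprod0 mulr1. Qed.

Lemma power_product_expansionP a g :
  power_product_expansion a g <->
  forall m, (pprod g m)`_m = a m.
Proof.
split=> [ag m | ag m]; last first.
  by exists m => N le_mN; rewrite -(ag m); apply: coef_pprod_stable.
have [N0 agm] := ag m.
by rewrite -(agm (maxn m N0) (leq_maxr _ _)); apply/esym/coef_pprod_stable/leq_maxl.
Qed.

Lemma power_product_expansion_unique a g h :
    power_product_expansion a g -> power_product_expansion a h ->
  forall n, (0 < n)%N -> g n = h n.
Proof.
move=> /power_product_expansionP ag /power_product_expansionP ah n.
elim/ltn_ind: n => -[//|n] IH _.
have eq_gh: pprod g n = pprod h n.
  by apply: eq_big_nat => k /andP[k_gt0 lt_kn]; rewrite IH.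
apply: (@addrI _ (pprod g n)`_n.+1).
by rewrite -coef_pprod_diag {1}eq_gh -coef_pprod_diag [LHS]ag [RHS]ah.
Qed.

Lemma power_product_expansion_exists a :
  a 0 = 1 -> exists g, power_product_expansion a g.
Proof.
move=> a0.
pose s := fix s N : seq K := if N is N'.+1 then
  rcons (s N') (a N - (pprod (nth 0 (s N')) N')`_N) else [:: 0].
have size_s N : size (s N) = N.+1 by elim: N => //= N IH; rewrite size_rcons IH.
pose g N := (s N)`_N.
have gs N k : (k <= N)%N -> (s N)`_k = g k.
  elim: N => [|N IH]; first by rewrite leqn0 => /eqP->.
  rewrite leq_eqVlt => /predU1P[-> //|lt_kN].
  by rewrite /= nth_rcons size_s lt_kN IH.
exists g; apply/power_product_expansionP => -[|n].
  by rewrite a0; apply: coef_pprod0.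
rewrite [LHS]coef_pprod_diag {2}/g /= nth_rcons size_s ltnn eqxx.
rewrite (_ : pprod (nth 0 (s n)) n = pprod g n) ?subrKC ?addrCA ?subrr ?addr0 //.
by apply: eq_big_nat => k /andP[_ lt_kn]; rewrite gs.
Qed.

End ExistenceUniqueness.

Notation Qq := {fraction {poly rat}}.
Notation "p %:F" := (@FracField.tofrac {poly rat} p) : ring_scope.

Definition qint (n : nat) : {poly rat} := \sum_(i < n) 'X^i.

Definition qfact (n : nat) : {poly rat} := \prod_(1 <= j < n.+1) qint j.

(* [gcdp] is only determined up to a nonzero constant; this is its monic
   representative (0 when both arguments are 0). *)
Definition monic_gcdp (F : fieldType) (p q : {poly F}) : {poly F} :=
  (lead_coef (gcdp p q))^-1 *: gcdp p q.

Definition qexp_coef (n : nat) : Qq := (qfact n)%:F^-1.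

Lemma qexp_coef0 : qexp_coef 0 = 1.
Proof. by rewrite /qexp_coef /qfact big_nil rmorph1 invr1. Qed.

Definition u (n : nat) : {poly rat} :=
  \prod_(1 <= j < n.+1) monic_gcdp (qint j) (qint n).

Definition r (e : nat -> Qq) (n : nat) : Qq := (u n)%:F * e n.

(* Main.v *)
(* Logarithmic differentiation of the product expansion, together with
   log exp_q(x) = sum_k (1-q)^(k-1) x^k / (k [k]), gives
     - sum_(k | n) k (-e_k)^(n/k) = (1-q)^(n-1) / [n].
   Since gcd([j],[n]) = [gcd(j,n)], both [n] and u_k^(n/k) (for k | n) divide
   u_n, so by induction n r_n is a polynomial over Q.  In degree, the terms k = 1
   and (1-q)^(n-1)/[n] cancel to first order, leaving
   e_n = (-1)^n q^-1 + O(q^-2) at infinity: the terms with 1 < k < n are of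
   order q^-(n/k).  Integrality does not follow from this relation because
   of the division by n, but solving the product expansion itself recursively
   only ever divides by the monic integer polynomials [n]!, so r_n is a rational
   polynomial that is a quotient of integer polynomials with monic denominator. *)
Require Import Defs.
From mathcomp Require Import all_boot all_order all_algebra.
From mathcomp Require Import ring zify.

Import GRing.Theory.
Local Open Scope ring_scope.

(** * Logarithmic differentiation of finite products, modulo powers of ['X] *)

Section LogDerivative.

Variable K : fieldType.
Implicit Types a g c : nat -> K.

Let y g k : {poly K} := (- g k) *: 'X^k.

(** With P = [pprod g N], each factor is 1 - y_k, so X P'/P = - sum_k k y_k / (1 - y_k). The
    geometric series is cut after [M] terms to stay within polynomials. *)
Definition log_deriv g N M : {poly K} :=
  - \sum_(1 <= k < N.+1) (\sum_(1 <= j < M.+1) y g k ^+ j) *+ k.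

Lemma pprod_log_deriv g N M :
  'X^(M.+1) %| 'X * (pprod g N)^`() - pprod g N * log_deriv g N M.
Proof.
rewrite /log_deriv; elim: N => [|N IH].
  by rewrite /pprod !big_nil derivC mulr0 oppr0 mulr0 subr0 dvdp0.
rewrite pprodS [in X in _ %| X]big_nat_recr //=.
set S := \sum_(1 <= k < N.+1) _; set T := \sum_(1 <= j < _) _.
have Ey : g N.+1 *: 'X^(N.+1) = - y g N.+1 by rewrite /y scaleNr opprK.
have Tgeom : T * (1 - y g N.+1) = y g N.+1 - y g N.+1 ^+ M.+1.
  rewrite /T; elim: {+}M => [|m IHm]; first by rewrite big_nil mul0r expr1 subrr.
  by rewrite big_nat_recr //= mulrDl IHm !exprS; ring.
have Xd : 'X * (1 + g N.+1 *: 'X^(N.+1))^`() = - y g N.+1 *+ N.+1.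
  rewrite derivD derivZ derivXn [1^`()]derivC add0r /= -scalerAr mulrnAr -exprS.
  by rewrite -scalerMnr Ey.
have dvd_y : 'X^(M.+1) %| y g N.+1 ^+ M.+1.
  by apply: dvdp_exp2r; rewrite /y -mul_polyC dvdp_mull // exprS dvdp_mulr.
rewrite derivM mulrDr mulrCA [_ * (_ * _^`())]mulrCA Xd Ey.
set d := (pprod g N)^`(); set P := pprod g N in IH d *.
(* By [Tgeom] the new factor contributes only its truncation error, and the rest is the induction
   hypothesis times 1 - y. *)
match goal with |- is_true (_ %| ?x) => have -> : x =
  ('X * d - P * - S) * (1 - y g N.+1) - P * y g N.+1 ^+ M.+1 *+ N.+1 end.
  rewrite -[LHS]addr0 -(subrr (P * (T * (1 - y g N.+1)) *+ N.+1)) {1}Tgeom; ring.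
by rewrite dvdp_sub ?dvdp_mulr // -mulr_natr dvdp_mulr // dvdp_mull.
Qed.

Lemma coef_log_deriv g n :
  (0 < n)%N ->
  (log_deriv g n n)`_n = - \sum_(1 <= k < n.+1 | (k %| n)%N) (- g k) ^+ (n %/ k) *+ k.
Proof.
move=> n_gt0; rewrite coefN coef_sum; congr (- _).
rewrite [RHS]big_mkcond; apply: eq_big_nat => k /andP[k_gt0 _].
rewrite coefMn coef_sum.
have Ej j : (y g k ^+ j)`_n = if n == (k * j)%N then (- g k) ^+ j else 0.
  by rewrite exprZn -exprM coefZ coefXn; case: eqP; rewrite ?mulr1 ?mulr0.
under eq_bigr do rewrite Ej.
case: ifPn => [/dvdnP[j En]|ndv]; last first.
  rewrite big1 ?mul0rn // => j _; case: eqP => // En.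
  by rewrite En dvdn_mulr in ndv.
have j_gt0 : (0 < j)%N by move: n_gt0; rewrite En muln_gt0 => /andP[].
rewrite (bigD1_seq j) ?iota_uniq ?mem_index_iota //=; last first.
  by rewrite j_gt0 ltnS En leq_pmulr.
rewrite En mulnK // mulnC eqxx big1 ?addr0 // => i /negPf ij.
by rewrite eqn_pmul2l // eq_sym ij.
Qed.

(** The hypothesis on [c] says x A' = C A for the generating series. The coefficients of [log_deriv]
    satisfy the same recursion up to [n], and a_0 = 1 makes its solution unique. *)
Lemma expansion_log_deriv a g c :
    power_product_expansion a g ->
    (forall n, a n *+ n = \sum_(1 <= i < n.+1) c i * a (n - i)%N) ->
  forall n, (0 < n)%N ->
  c n = - \sum_(1 <= k < n.+1 | (k %| n)%N) (- g k) ^+ (n %/ k) *+ k.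
Proof.
move=> /power_product_expansionP ag ac n n_gt0; rewrite -coef_log_deriv //.
have a0 : a 0 = 1 by rewrite -ag coef_pprod0.
set L := log_deriv g n n.
have convol m : (m <= n)%N -> a m *+ m = \sum_(i < m.+1) L`_i * a (m - i)%N.
  move=> le_mn; have /dvdpP[Q EQ] := pprod_log_deriv g n n.
  have := congr1 (fun p : {poly K} => p`_m) EQ.
  rewrite coefMXn ltnS le_mn coefB => /eqP; rewrite subr_eq0 => /eqP.
  rewrite coefXM coef_deriv mulrC coefM => Em.
  transitivity (if m == 0 then 0 else (pprod g n)`_m.-1.+1 *+ m.-1.+1).
    by case: (m) le_mn => // k le_kn; rewrite /= coef_pprod_stable // ag.
  rewrite Em; apply: eq_bigr => i _; congr (_ * _).
  by rewrite coef_pprod_stable ?ag //; lia.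
have L0 : L`_0 = 0.
  by have := convol 0 isT; rewrite big_ord1 a0 mulr1 mulr0n => <-.
suff : forall m, (0 < m <= n)%N -> c m = L`_m by apply; rewrite n_gt0 leqnn.
elim/ltn_ind=> -[//|m] IH /= le_mn.
have := convol _ le_mn; rewrite ac big_add1 big_mkord.
rewrite [X in _ = X]big_ord_recl /= L0 mul0r add0r.
rewrite !big_ord_recr /= subnn a0 !mulr1.
rewrite (eq_bigr (fun i : 'I_m => L`_i.+1 * a (m.+1 - i.+1)%N)) => [/addrI //|i _].
by rewrite IH // ?ltnS; have := ltn_ord i; lia.
Qed.

End LogDerivative.

(** * Divisibility, gcds and degrees of q-integers and of [u] *)

Section QIntegers.

Lemma qint0 : qint 0 = 0.
Proof. by rewrite /qint big_ord0. Qed.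

Lemma qintS n : qint n.+1 = qint n + 'X^n.
Proof. by rewrite /qint big_ord_recr. Qed.

Lemma qint1 : qint 1 = 1.
Proof. by rewrite qintS qint0 add0r expr0. Qed.

Lemma qintD m n : qint (m + n) = qint m + 'X^m * qint n.
Proof.
elim: n => [|n IH]; first by rewrite addn0 qint0 mulr0 addr0.
by rewrite addnS !qintS IH mulrDr addrA exprD.
Qed.

Lemma mul_1subX_qint n : (1 - 'X) * qint n = 1 - 'X^n.
Proof.
rewrite -[1 in RHS](expr1n _ n) subrXX; congr (_ * _).
by apply: eq_bigr => i _; rewrite expr1n mul1r.
Qed.

Lemma qint_poly n : qint n = \poly_(i < n) 1.
Proof. by rewrite poly_def; apply: eq_bigr => i _; rewrite scale1r. Qed.

Lemma size_qint n : size (qint n) = n.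
Proof.
by case: n => [|n]; rewrite ?qint0 ?size_poly0 // qint_poly size_poly_eq ?oner_eq0.
Qed.

Lemma qint_monic n : (0 < n)%N -> qint n \is monic.
Proof.
case: n => // n _.
by rewrite monicE lead_coefE size_qint qint_poly coef_poly ltnSn.
Qed.

Lemma dvdp_qint m n : (m %| n)%N -> qint m %| qint n.
Proof.
case/dvdnP=> k ->; elim: k => [|k IH]; first by rewrite qint0 dvdp0.
by rewrite mulSn qintD dvdp_add // dvdp_mull.
Qed.

(** Subtractive Euclid on the indices: [n] = [n-m] + q^(n-m) [m], so [n] and [n-m] have the same gcd
    with [m]. *)
Lemma gcdp_qint m n : gcdp (qint m) (qint n) %= qint (gcdn m n).
Proof.
have [s] := ubnP (m + n)%N; elim: s m n => // s IH m n lt_s.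
wlog le_mn : m n lt_s / (m <= n)%N.
  move=> W; case: (leqP m n) => [|/ltnW] le; first exact: W.
  by rewrite gcdnC (eqp_trans (gcdpC _ _)) // W // addnC.
have [->|m_gt0] := posnP m; first by rewrite qint0 gcd0p gcd0n eqpxx.
rewrite -(subnK le_mn) qintD gcdnDr addrC.
apply: eqp_trans (IH _ _ _); last by lia.
by rewrite gcdp_addl_mul.
Qed.

Lemma monic_gcdp_qint m n : (0 < n)%N ->
  monic_gcdp (qint m) (qint n) = qint (gcdn m n).
Proof.
move=> n_gt0; have /eqpP[[a b] /= /andP[a0 b0] E] := gcdp_qint m n.
have g_gt0 : (0 < gcdn m n)%N by rewrite gcdn_gt0 n_gt0 orbT.
have L : a * lead_coef (gcdp (qint m) (qint n)) = b.
  by rewrite -lead_coefZ E lead_coefZ (monicP (qint_monic _ g_gt0)) // mulr1.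
rewrite /monic_gcdp.
apply: (scalerI b0); rewrite -E scalerA -L mulfK //.
by apply: contraNneq b0 => l0; rewrite -L l0 mulr0.
Qed.

Lemma uE n : u n = \prod_(1 <= j < n.+1) qint (gcdn j n).
Proof. by apply: eq_big_nat => j lt; rewrite monic_gcdp_qint //; lia. Qed.

Lemma u_monic n : u n \is monic.
Proof.
rewrite uE big_seq; apply: monic_prod => j; rewrite mem_index_iota => j_bd.
by rewrite qint_monic // gcdn_gt0; lia.
Qed.

Lemma qint_dvd_u n : (0 < n)%N -> qint n %| u n.
Proof.
by case: n => // n _; rewrite uE big_nat_recr //= gcdnn dvdp_mull.
Qed.

Lemma prod_qint_gcdn k m :
  \prod_(1 <= j < (m * k).+1) qint (gcdn j k) = u k ^+ m.
Proof.
elim: m => [|m IH]; first by rewrite mul0n big_nil.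
(* The last k consecutive indices form a full period and contribute one more factor [u k]. *)
rewrite (@big_cat_nat _ _ _ (m * k).+1) //=; last by rewrite ltnS leq_mul2r leqnSn orbT.
rewrite IH exprSr uE; congr (_ * _).
rewrite -[X in \big[_/_]_(X <= _ < _) _]add1n big_addn.
have -> : ((m.+1 * k).+1 - m * k = k.+1)%N by rewrite mulSn; lia.
by apply: eq_bigr => j _; rewrite gcdnC addnC gcdnMDl gcdnC.
Qed.

(* j |-> gcd(j, k) is k-periodic, and [gcd(j, k)] divides [gcd(j, n)]. *)
Lemma u_exp_dvd k n : (k %| n)%N -> u k ^+ (n %/ k) %| u n.
Proof.
move=> kn; rewrite -prod_qint_gcdn divnK // uE.
apply: (big_ind2 (fun p q : {poly rat} => p %| q)) => // [p1 p2 q1 q2|j _].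
  exact: dvdp_mul.
by apply: dvdp_qint; rewrite dvdn_gcd dvdn_gcdl (dvdn_trans _ kn) // dvdn_gcdr.
Qed.

Lemma qfactS n : qfact n.+1 = qint n.+1 * qfact n.
Proof. by rewrite /qfact big_nat_recr //= mulrC. Qed.

Lemma coef_expXsub1 m : (('X - 1 : {poly rat}) ^+ m.+1)`_m = - m.+1%:R.
Proof.
elim: m => [|m IH]; first by rewrite expr1 coefB coefX coef1 sub0r.
rewrite exprS mulrBl mul1r coefB coefXM /= IH.
have := monic_exp m.+1 (monicXsubC (1 : rat)).
by rewrite monicE lead_coefE size_exp_XsubC /= => /eqP->; rewrite -opprD natr1.
Qed.

(** Both polynomials are monic of degree n+1, so their tops cancel; the next coefficients are 1 and
    -(n+1). *)
Lemma qint_sub_exp n (d := qint n.+2 - ('X - 1) ^+ n.+1) :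
  size d = n.+1 /\ lead_coef d = n.+2%:R.
Proof.
have dn : d`_n = n.+2%:R.
  by rewrite coefB coef_expXsub1 qint_poly coef_poly ltnW ?ltnSn // opprK nat1r.
have sz : size d = n.+1.
  apply/eqP; rewrite eqn_leq; apply/andP; split; last first.
    rewrite ltnNge; apply: contraTN isT => /leq_sizeP/(_ n (leqnn _)) /eqP.
    by rewrite dn Num.Theory.pnatr_eq0.
  apply/leq_sizeP => j; rewrite leq_eqVlt => /predU1P[<-|lt_j].
    rewrite coefB qint_poly coef_poly ltnSn.
    have := monic_exp n.+1 (monicXsubC (1 : rat)).
    by rewrite monicE lead_coefE size_exp_XsubC /= => /eqP->; rewrite subrr.
  rewrite nth_default // (leq_trans (size_polyD _ _)) // size_polyN size_qint.
  by rewrite size_exp_XsubC maxnn.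
by rewrite lead_coefE sz.
Qed.

End QIntegers.

(** * The logarithmic derivative of the q-exponential *)

Section LogQExp.

(* [b n] and [f n] are [n] and [n]!, so that [1 / f n] are the coefficients
   of the q-exponential and [(1 - q)^(n-1) / (n b n)] those of its logarithm. *)
Lemma qexp_log_deriv_gen (K : fieldType) (q : K) (b f : nat -> K) :
    (forall m n, b (m + n)%N = b m + q ^+ m * b n) ->
    (forall n, (1 - q) * b n = 1 - q ^+ n) -> (forall n, b n.+1 != 0) ->
    f 0 = 1 -> (forall n, f n.+1 = b n.+1 * f n) ->
  forall n, (f n)^-1 *+ n =
    \sum_(1 <= i < n.+1) ((1 - q) ^+ i.-1 / b i) * (f (n - i)%N)^-1.
Proof.
move=> bD b1 b0 f0 fS.
have fn0 i : f i != 0 by elim: i => [|i IH]; rewrite ?f0 ?oner_eq0 // fS mulf_neq0.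
move=> n; apply: (mulfI (fn0 n)); rewrite mulrnAr divff //.
elim: n => [|n IH]; first by rewrite big_nil mulr0.
(* Passing from n to n+1 changes the i-th term by s_(i-1) - s_i, which telescopes to 1 - s_n; the
   extra term i = n+1 equals s_n, so the sum grows by 1. *)
pose s i := f n / f (n - i)%N * (1 - q) ^+ i.
rewrite mulr_sumr big_nat_recr //= subnn f0 invr1 mulr1.
pose t i := f n * ((1 - q) ^+ i.-1 / b i * (f (n - i)%N)^-1).
rewrite (@eq_big_nat _ _ _ _ _ _ (fun i => t i - (s i - s i.-1))).
  rewrite sumrB -mulr_sumr -IH big_add1 /= telescope_sumr //.
  rewrite /s subnn subn0 f0 fS expr0 mulrSr.
  by field; rewrite b0 fn0 oner_eq0.
case=> [//|i] /andP[_ lt_in]; rewrite /t /s /=.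
have [m ->] : exists m, n = (m + i.+1)%N by exists (n - i.+1)%N; lia.
have -> : ((m + i.+1).+1 - i.+1 = m.+1)%N by lia.
have -> : (m + i.+1 - i.+1 = m)%N by lia.
have -> : (m + i.+1 - i = m.+1)%N by lia.
rewrite [f (m + _).+1]fS [f m.+1]fS -addSn [b (m.+1 + _)%N]bD [(1 - q) ^+ _.+1]exprS.
have -> : q ^+ m.+1 = 1 - (1 - q) * b m.+1 by rewrite b1; ring.
by field; rewrite !b0 fn0.
Qed.

End LogQExp.

(** * Fractions of integer polynomials with monic denominator *)

Section IntegralFractions.

Definition int_frac (p : {poly int}) : Qq := (map_poly intr p)%:F.

Definition monic_denom (x : Qq) : Prop :=
  exists m p : {poly int}, m \is monic /\ x * int_frac m = int_frac p.

Lemma int_fracD p q : int_frac (p + q) = int_frac p + int_frac q.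
Proof. by rewrite /int_frac !rmorphD. Qed.

Lemma int_fracN p : int_frac (- p) = - int_frac p.
Proof. by rewrite /int_frac !rmorphN. Qed.

Lemma int_fracM p q : int_frac (p * q) = int_frac p * int_frac q.
Proof. by rewrite /int_frac !rmorphM. Qed.

Lemma monic_denom_int p : monic_denom (int_frac p).
Proof. by exists 1, p; rewrite monic1 -int_fracM mulr1. Qed.

Lemma monic_denom0 : monic_denom 0.
Proof. by have := monic_denom_int 0; rewrite /int_frac !rmorph0. Qed.

Lemma monic_denom1 : monic_denom 1.
Proof. by have := monic_denom_int 1; rewrite /int_frac !rmorph1. Qed.

Lemma monic_denomN x : monic_denom x -> monic_denom (- x).
Proof.
by case=> [m [p [mm E]]]; exists m, (- p); rewrite int_fracN -E mulNr.
Qed.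

Lemma monic_denomD x y : monic_denom x -> monic_denom y -> monic_denom (x + y).
Proof.
case=> [m [p [mm Ep]]] [m' [p' [mm' Ep']]].
exists (m * m'), (p * m' + p' * m); split; first by rewrite monicMl.
by rewrite int_fracD !int_fracM -Ep -Ep'; ring.
Qed.

Lemma monic_denomM x y : monic_denom x -> monic_denom y -> monic_denom (x * y).
Proof.
case=> [m [p [mm Ep]]] [m' [p' [mm' Ep']]].
exists (m * m'), (p * p'); split; first by rewrite monicMl.
by rewrite !int_fracM -Ep -Ep'; ring.
Qed.

Lemma monic_denom_pprod (g : nat -> Qq) N :
    (forall k, (0 < k <= N)%N -> monic_denom (g k)) ->
  forall m, monic_denom (pprod g N)`_m.
Proof.
elim: N => [|N IH] gN m.
  rewrite /pprod big_nil coef1.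
  by case: eqP => _; [apply: monic_denom1 | apply: monic_denom0].
have {}IH := IH (fun k lt => gN k (ltac:(lia))).
rewrite coef_pprodS; apply: monic_denomD => //; apply: monic_denomM.
  by apply: gN; rewrite /= leqnn.
by case: ifP => _ //; apply: monic_denom0.
Qed.

(** The coefficient of x^n gives g_n as a_n minus an integer polynomial expression in the earlier
    g_k, without any division. *)
Lemma monic_denom_expansion (a g : nat -> Qq) :
    power_product_expansion a g -> (forall n, monic_denom (a n)) ->
  forall n, (0 < n)%N -> monic_denom (g n).
Proof.
move=> /power_product_expansionP ag a_int; elim/ltn_ind=> -[//|n] IH _.
have -> : g n.+1 = a n.+1 - (pprod g n)`_n.+1.
  by rewrite -ag coef_pprod_diag addrC addKr.
apply: monic_denomD => //; apply/monic_denomN/monic_denom_pprod => k k_bd.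
by apply: IH; lia.
Qed.

Lemma map_qint n : map_poly intr (\sum_(i < n) 'X^i : {poly int}) = qint n.
Proof. by rewrite rmorph_sum; apply: eq_bigr => i _; rewrite /= map_polyXn. Qed.

Lemma qint_intP n : (0 < n)%N ->
  exists2 p : {poly int}, p \is monic & map_poly intr p = qint n.
Proof.
move=> n_gt0; exists (\sum_(i < n) 'X^i); last exact: map_qint.
apply/monicP/(@intr_inj rat).
rewrite -lead_coef_map_inj ?map_qint //; last exact: intr_inj.
exact/monicP/qint_monic.
Qed.

(** The general index function covers both [n]! and [u n]. *)
Lemma prod_qint_intP (I : eqType) (s : seq I) (F : I -> nat) :
    (forall i, i \in s -> (0 < F i)%N) ->
  exists2 p : {poly int}, p \is monic & map_poly intr p = \prod_(i <- s) qint (F i).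
Proof.
move=> F_gt0; rewrite big_seq; elim/big_rec: _ => [|i q /F_gt0/qint_intP[p pm pE] [r rm <-]].
  by exists 1; rewrite ?monic1 ?rmorph1.
by exists (p * r); rewrite ?monicMl // rmorphM /= pE.
Qed.

Lemma monic_denom_qexp n : monic_denom (qexp_coef n).
Proof.
have [|p pm pE] := @prod_qint_intP _ (index_iota 1 n.+1) id.
  by move=> i; rewrite mem_index_iota => /andP[].
exists p, 1; split=> //; rewrite /int_frac /qexp_coef /qfact -pE !rmorph1 mulVf //.
by rewrite tofrac_eq0 map_poly_eq0_id0 ?monic_neq0 // (monicP pm).
Qed.

(* Long division by a monic polynomial does not leave [int]. *)
Lemma monic_dvdp_int (m p : {poly int}) (w : {poly rat}) : m \is monic ->
  w * map_poly intr m = map_poly intr p -> exists a, w = map_poly intr a.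
Proof.
move=> mm E; pose a := Pdiv.CommonRing.rdivp p m; exists a.
pose b := Pdiv.CommonRing.rmodp p m.
have Eb : (w - map_poly intr a) * map_poly intr m = map_poly intr b.
  by rewrite mulrBl E (Pdiv.RingMonic.rdivp_eq mm p) rmorphD rmorphM /= addrC addKr.
have size_int (q : {poly int}) : size (map_poly intr q : {poly rat}) = size q.
  by apply: size_map_inj_poly => //; apply: intr_inj.
(* A nonzero difference would make the remainder [b] at least as large in degree as [m]. *)
apply/eqP; rewrite -subr_eq0; apply: contraTT isT => d0.
have m0 : map_poly intr m != 0 :> {poly rat}.
  by rewrite -size_poly_eq0 size_int size_poly_eq0 monic_neq0.
have := congr1 (size \o polyseq) Eb; rewrite /= size_mul // !size_int.
have := Pdiv.CommonRing.ltn_rmodpN0 p (monic_neq0 mm); rewrite -/b.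
move: d0; rewrite -size_poly_gt0; case: (size (w - _)) => // s _ lt_bm eq_b.
by move: lt_bm; rewrite -eq_b addSn /= ltnNge leq_addl.
Qed.

End IntegralFractions.

(** * Degree and leading coefficient of r_n over the rationals *)

Lemma leq_size_u n : (0 < n)%N -> (n <= size (u n))%N.
Proof.
move=> n_gt0; rewrite -[n in (n <= _)%N]size_qint.
by rewrite dvdp_leq ?qint_dvd_u // monic_neq0 ?u_monic.
Qed.

Section DegreeOfR.

Variable e : nat -> Qq.
Hypothesis e_expansion : power_product_expansion qexp_coef e.

Lemma divisor_sum_e n : (0 < n)%N ->
  (1 - 'X)%:F ^+ n.-1 / (qint n)%:F =
    - \sum_(1 <= k < n.+1 | (k %| n)%N) (- e k) ^+ (n %/ k) *+ k.
Proof.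
move=> n_gt0; pose c k : Qq := (1 - 'X%:F) ^+ k.-1 / (qint k)%:F.
rewrite rmorphB rmorph1 -[LHS]/(c n).
move: n n_gt0; apply: expansion_log_deriv e_expansion _ => n.
apply: (@qexp_log_deriv_gen _ _ (fun k => (qint k)%:F) (fun k => (qfact k)%:F)).
- by move=> i j; rewrite qintD rmorphD rmorphM rmorphXn.
- move=> i; rewrite -[1](rmorph1 (@FracField.tofrac {poly rat})) -rmorphB -rmorphM.
  by rewrite mul_1subX_qint rmorphB rmorphXn.
- by move=> i; rewrite tofrac_eq0 monic_neq0 // qint_monic.
- by rewrite /qfact big_nil rmorph1.
- by move=> i; rewrite qfactS rmorphM.
Qed.

(** Index 1 is exceptional: r_1 = u_1 = 1 shows no drop in degree, so the term k = 1 has to be known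
    exactly. *)
Lemma e1 : e 1 = 1.
Proof.
have := divisor_sum_e 1 isT.
rewrite big_mkcond big_nat1 divn1 dvd1n expr0 qint1 rmorph1 divr1.
by move=> ->; rewrite expr1 mulr1n opprK.
Qed.

(** Multiplying the divisor relation by u_N, with v = u_N / [N], gives N r_N = (-1)^N v ([N] -
    (q-1)^(N-1)) + b, where [b] collects the divisors 1 < k < N. The first summand has degree deg
    u_N - 1 and leading coefficient (-1)^N N. *)
Lemma r_poly n : (1 < n)%N ->
  exists w : {poly rat},
    [/\ r e n = w%:F, size w = (size (u n)).-1 & lead_coef w = (-1) ^+ n].
Proof.
elim/ltn_ind: n => -[|[|n]] // IH _; set N := n.+2.
have [v Ev] := dvdpP _ _ (qint_dvd_u N isT).
have u0 k : u k != 0 by rewrite monic_neq0 ?u_monic.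
have v0 : v != 0 by apply: contraNneq (u0 N) => v0; rewrite Ev v0 mul0r.
have q0 : qint N != 0 by rewrite monic_neq0 ?qint_monic.
have size_uN : size (u N) = (size v + n.+1)%N.
  by rewrite Ev size_mul // size_qint /N addnS.
have lead_v : lead_coef v = 1.
  have := monicP (u_monic N).
  by rewrite Ev lead_coefM (monicP (qint_monic _ (ltn0Sn n.+1))) mulr1.
have [b Eb size_b] : exists2 b : {poly rat},
    \sum_(2 <= k < N | (k %| N)%N) (u N)%:F * ((- e k) ^+ (N %/ k) *+ k) = b%:F &
    (size b < (size (u N)).-1)%N.
  rewrite big_nat_cond.
  elim/big_ind: _ => [|x y [b -> sb] [b' -> sb']|k /andP[/andP[k_gt1 k_lt] kN]].
  - exists 0; rewrite ?rmorph0 // size_poly0; have := size_poly_gt0 v; rewrite v0 => sv0.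
    by rewrite size_uN; lia.
  - exists (b + b'); rewrite ?rmorphD //.
    by rewrite (leq_ltn_trans (size_polyD _ _)) // gtn_max sb sb'.
  have [w [Ew size_w _]] := IH k k_lt k_gt1.
  have [vk Evk] := dvdpP _ _ (u_exp_dvd k N kN).
  set j := (N %/ k)%N in Evk *.
  have j_gt1 : (1 < j)%N by rewrite /j; move/dvdnP: kN => [i Ei]; rewrite Ei mulnK; nia.
  have vk0 : vk != 0 by apply: contraNneq (u0 N) => v0'; rewrite Evk v0' mul0r.
  (* In u_N = vk u_k^j, replacing u_k by [w], of degree one less, lowers the degree by j, and j >= 2
     because k < N. *)
  exists ((-1) ^+ j * vk * w ^+ j *+ k).
    rewrite rmorphMn !rmorphM !rmorphXn rmorphN rmorph1 /= -Ew /r Evk rmorphM rmorphXn.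
    by rewrite exprNn exprMn mulrnAr; congr (_ *+ _); ring.
  rewrite -scaler_nat (leq_ltn_trans (size_scale_leq _ _)) //.
  rewrite -mulrA size_Msign.
  rewrite (leq_ltn_trans (size_polyMleq _ _)) //.
  have := size_exp w j; have := size_exp (u k) j; rewrite Evk.
  rewrite size_mul ?expf_neq0 //.
  have := leq_size_u k (ltnW k_gt1); have := size_poly_gt0 vk; rewrite vk0 size_w.
  move: (size vk) (size (u k)) (size (u k ^+ j)) (size (w ^+ j)) => sv sk sku sw.
  case: sk => [|[|a]] /=; rewrite ?mulSn => *; lia.
have [sD lD] := qint_sub_exp n; set D := _ - _ in sD lD.
have D0 : D != 0 by rewrite -size_poly_gt0 sD.
have sz_vD : size (v * D) = (size (u N)).-1 by rewrite size_mul // sD size_uN !addnS.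
have En : r e N *+ N = ((-1) ^+ N * (v * D) + b)%:F.
  have ED : (-1) ^+ N * (v * D) = (-1) ^+ N * u N + v * (1 - 'X) ^+ n.+1.
    rewrite mulrBr mulrBr -Ev -[_ - 1]opprB [(- (1 - 'X)) ^+ _]exprNn; congr (_ + _).
    by rewrite [v * (_ * _)]mulrCA [_ ^+ N]exprS mulN1r mulNr opprK signrMK.
  have := divisor_sum_e N isT.
  rewrite big_mkcond big_ltn // dvd1n divn1 e1 big_nat_recr //= dvdnn divnn /= expr1.
  rewrite -big_mkcond => H.
  have -> : r e N *+ N = (u N)%:F * ((1 - 'X)%:F ^+ n.+1 / (qint N)%:F) +
      (u N)%:F * (-1) ^+ N + b%:F.
    rewrite -Eb -mulr_sumr /r -mulrnAr -!mulrDr; congr (_ * _).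
    by rewrite H mulr1n mulNrn addrA opprB -addrA subrK.
  have -> : (u N)%:F * ((1 - 'X)%:F ^+ n.+1 / (qint N)%:F) = v%:F * (1 - 'X)%:F ^+ n.+1.
    by rewrite Ev rmorphM -mulrA [_%:F * (_ / _)]mulrC divfK // tofrac_eq0.
  rewrite ED [in RHS]tofracD [in RHS]tofracD [(_ * u N)%:F]tofracM [(v * _)%:F]tofracM.
  rewrite !tofracXn tofracN tofrac1.
  by rewrite [_ * (-1) ^+ N]mulrC [v%:F * _ + _]addrC.
(* Dividing by N keeps only rational coefficients in sight, but it cancels the leading coefficient N
   of [D]. *)
exists (N%:R^-1 *: ((-1) ^+ N * (v * D) + b)).
have N0 : N%:R^-1 != 0 :> rat by rewrite invr_eq0 Num.Theory.pnatr_eq0.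
split.
- rewrite -mul_polyC tofracM -En -[r e N *+ N]mulr_natl mulrA.
  have -> : N%:R = (N%:R%:P)%:F :> Qq by rewrite polyC_natr rmorph_nat.
  by rewrite -tofracM -polyCM mulVf ?Num.Theory.pnatr_eq0 // tofrac1 mul1r.
- by rewrite size_scale // size_polyDl size_Msign sz_vD.
- rewrite lead_coefZ lead_coefDl ?size_Msign ?sz_vD // lead_coefM lead_coef_exp.
  rewrite lead_coefN lead_coef1 lead_coefM lD lead_v mul1r mulrC mulfK //.
  by rewrite Num.Theory.pnatr_eq0.
Qed.

End DegreeOfR.

(** * Integrality of r_n, combined with its leading coefficient *)

Theorem theorem4p2 (e : nat -> Qq)
    (e_expansion : power_product_expansion qexp_coef e)
    (n : nat) (n_gt1 : (1 < n)%N) :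
  exists p : {poly int},
    (-1) ^+ n * r e n = (map_poly intr p)%:F /\ lead_coef p = 1.
Proof.
have [w [Ew _ lead_w]] := r_poly e e_expansion n n_gt1.
have [m [p [mm Ep]]] :=
  monic_denom_expansion _ _ e_expansion monic_denom_qexp n (ltnW n_gt1).
have [|U _ EU] := prod_qint_intP _ (index_iota 1 n.+1) (fun j => gcdn j n).
  by move=> j; rewrite gcdn_gt0 (ltnW n_gt1) orbT.
have [a Ea] : exists a, w = map_poly intr a.
  (* Since e_n = p/m with [m] monic and [U] is [u n] over the integers, w m = U p, and exact
     division by [m] stays integral. *)
  apply: (monic_dvdp_int m (U * p) _ mm); rewrite rmorphM /= EU -uE.
  apply/eqP; rewrite -tofrac_eq !tofracM -Ew /r -mulrA; apply/eqP.
  by congr (_ * _).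
exists ((-1) ^+ n * a); split.
  by rewrite Ew Ea rmorphM rmorph_sign tofracM tofracXn tofracN tofrac1.
apply: (@intr_inj rat).
rewrite -lead_coef_map_inj //; last exact: intr_inj.
rewrite rmorphM rmorphXn rmorphN rmorph1 /= -Ea lead_coefM lead_w.
by rewrite lead_coef_exp lead_coefN lead_coef1 -expr2 sqrr_sign.
Qed.
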